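(* Let $p$ be the transition density of a subordinator as described in the context, and let $q\colon\mathbb{R}\to[0,\infty]$ be measurable. Assume that for some $s<t$, $$\sup_{x<y}\int_s^t\int_{\mathbb{R}}\frac{p(s,x,u,z)p(u,z,t,y)}{p(s,x,t,y)}q(z)\,dz\,du<\infty.$$ Then $q\in L^\infty(\mathbb{R})$.
   Context: A subordinator is a nondecreasing Lévy process on $\mathbb{R}$. We assume its distribution at each time $t>0$ has a density $p_t$ with respect to Lebesgue measure, and set $p(s,x,t,y)=p_{t-s}(y-x)$ for $s<t$; $p(s,x,t,y)=0$ whenever $t\le s$ or $y\le x$, and $p(s,x,t,y)>0$ otherwise. *)

(* Defs.v *)
From HB Require Import structures.
From mathcomp Require Import all_boot all_order all_algebra.
From mathcomp Require Import all_classical all_reals all_analysis measurable_realfun ess_sup_inf.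
Set Implicit Arguments. Unset Strict Implicit. Unset Printing Implicit Defensive.
Import Order.TTheory GRing.Theory Num.Theory.
Import numFieldNormedType.Exports.
Local Open Scope classical_set_scope.
Local Open Scope ring_scope.

Section subordinator_defs.
Context {d : measure_display} {Omega : measurableType d} {R : realType}.
Variables (P : probability Omega R) (X : R -> Omega -> R).

Definition incr (s t : R) : Omega -> R := fun w => X t w - X s w.

Definition indep_increments : Prop :=
  forall (n : nat) (t : nat -> R) (B : nat -> set R),
    0 <= t 0%N ->
    (forall i, (i < n)%N -> t i < t i.+1) ->
    (forall i, measurable (B i)) ->
    P (\bigcap_(i < n) [set w | B i (incr (t i) (t i.+1) w)]) =
    (\prod_(i < n) P [set w | B i (incr (t i) (t i.+1) w)])%E.

Definition stationary_increments : Prop :=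
  forall (s t : R) (B : set R), 0 <= s -> s <= t -> measurable B ->
    P [set w | B (incr s t w)] = P [set w | B (incr 0 (t - s) w)].

Definition stoch_continuous : Prop :=
  forall (t e eta : R), 0 <= t -> 0 < e -> 0 < eta ->
    exists2 delta : R, 0 < delta &
      forall s, 0 <= s -> `|s - t| < delta ->
        (P [set w | (e < `|X s w - X t w|)%R ] <= eta%:E)%E.

Definition levy_process : Prop :=
  [/\ (forall t, measurable_fun setT (X t)),
      ({ae P, forall w, X 0 w = 0}),
      (indep_increments /\ stationary_increments), stoch_continuous &
      ({ae P, forall w, forall t, 0 <= t -> (X^~ w) @ t^'+ --> X t w})].

Definition subordinator : Prop :=
  levy_process /\
  {ae P, forall w, forall s t, 0 <= s -> s <= t -> X s w <= X t w}.

Definition has_densities (p : R -> R -> R) : Prop :=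
  forall t, 0 < t ->
    measurable_fun setT (p t) /\
    forall B : set R, measurable B ->
      P [set w | B (X t w)] =
      (\int[lebesgue_measure]_(z in B) (p t z)%:E)%E.

End subordinator_defs.

Definition trans_dens {R : realType} (p : R -> R -> R) (s x t y : R) : R :=
  if s < t then p (t - s) (y - x) else 0.

(* Main.v *)
Require Import Defs.
From HB Require Import structures.
From mathcomp Require Import all_boot all_order all_algebra.
From mathcomp Require Import all_classical all_reals all_analysis measurable_realfun ess_sup_inf.
From mathcomp Require Import ring.
Import Order.TTheory GRing.Theory Num.Theory.
Import numFieldNormedType.Exports.
Local Open Scope classical_set_scope.
Local Open Scope ring_scope.

(** Write T = t - s and let C be the supremum.  Multiplying by p_T(y - x), the
    assumption says that for all x and all h > 0,
      int_s^t int p_{u-s}(w) p_{t-u}(h - w) q(x + w) dw du <= C p_T(h).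
    Suppose that q > M on a set of positive measure.  By regularity of Lebesgue
    measure that set contains a compact K of positive measure |K| which overlaps
    each of its translates by 0 < w < e in measure at least |K|/2.  Bound q below
    by M on K and integrate over x in K: since the densities live on (0, oo), only
    0 < w < h contribute, so for h < e
      M (|K|/2) int_s^t (p_{u-s} * p_{t-u})(h) du <= C |K| p_T(h).
    Integrating over h in (0, e) and using Chapman-Kolmogorov, which gives
    int_0^e (p_{u-s} * p_{t-u})(h) dh = P(X_T < e) =: c > 0 for every u, we get
    M T c / 2 <= C c, that is M <= 2 C / T.

    The given p_t need not be jointly measurable in (t, x), so Tonelli's theorem
    is applied to another version of the densities.  The distribution function
    P(X_t <= x) is jointly measurable because it is monotone in t and
    right-continuous in x, hence so is the upper limit of its difference
    quotients in x; by Lebesgue differentiation the latter is equal to p_t almost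
    everywhere for each t > 0. *)

Set Implicit Arguments.
Unset Strict Implicit.
Unset Printing Implicit Defensive.

(** * Lebesgue measure *)

Lemma eq_measure_ae {d : measure_display} {T : measurableType d} {R : realType}
    (m : {measure set T -> \bar R}) (A B : set T) :
  measurable A -> measurable B -> {ae m, forall x, A x <-> B x} -> m A = m B.
Proof.
move=> mA mB [N [mN N0 ABN]].
(* Adjoining the exceptional null set [N] turns both into the same set. *)
rewrite -(measureU0 mA mN N0) -(measureU0 mB mN N0); congr (m _).
have AB x : ~ N x -> A x <-> B x by move=> Nx; apply: contrapT => /ABN.
by apply/seteqP; split => x [] xA; have [Nx|/AB[? ?]] := pselect (N x);
  by [right|left; tauto].
Qed.

Section lebesgue_translation.
Context {R : realType}.
Local Notation mu := (@lebesgue_measure R).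
Local Open Scope ereal_scope.

Let measurable_addr (a : R) :
  measurable_fun setT ((fun x => x + a)%R : measurableTypeR R -> measurableTypeR R).
Proof. exact: measurable_funD. Qed.

(** The pushforward under translation gives half-open intervals their length, which characterises
    Lebesgue measure. *)
Lemma lebesgue_measure_translation (a : R) (A : set R) : measurable A ->
  mu [set x | A (x + a)%R] = mu A.
Proof.
move=> mA; apply/esym.
have := @lebesgue_measure_unique R
  (pushforward mu ((fun x => x + a)%R : _ -> measurableTypeR R)).
apply => //= _ [[b c]] _ <-; rewrite /pushforward.
rewrite (_ : _ @^-1` _ = `]b - a, c - a]%classic)%R; last first.
  by apply/seteqP; split=> x /=; rewrite !in_itv/= ltrBlDr lerBrDr.
rewrite !lebesgue_measure_itv/= !lte_fin ltrD2r; case: ifPn => // _.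
by rewrite -!EFinB opprB addrA subrK.
Qed.

Lemma ge0_integral_translation (a : R) (f : R -> \bar R) :
  measurable_fun setT f -> (forall x, 0 <= f x) ->
  \int[mu]_x f (x + a)%R = \int[mu]_x f x.
Proof.
move=> mf f0; transitivity (\int[pushforward mu
    ((fun x => x + a)%R : _ -> measurableTypeR R)]_x f x).
  by rewrite ge0_integral_pushforward// preimage_setT.
by apply: eq_measure_integral => //= A mA _; exact: lebesgue_measure_translation.
Qed.

End lebesgue_translation.

(** * Iterated integrals over measurable rectangles *)

Section tonelli_on_sets.
Local Open Scope ereal_scope.
Context {d1 d2 : measure_display} {T1 : measurableType d1}
  {T2 : measurableType d2} {R : realType}.
Variables (m1 : {sigma_finite_measure set T1 -> \bar R}).
Variables (m2 : {sigma_finite_measure set T2 -> \bar R}).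
Variables (D1 : set T1) (D2 : set T2) (f : T1 -> T2 -> \bar R).
Hypotheses (mD1 : measurable D1) (mD2 : measurable D2).
Hypotheses (mf : measurable_fun setT (fun z => f z.1 z.2)).
Hypothesis f0 : forall x y, 0 <= f x y.

Let h := (fun z => f z.1 z.2) \_ (D1 `*` D2).

Let mh : measurable_fun setT h.
Proof.
by apply/(measurable_restrictT _ _).1; [exact: measurableX|exact: measurable_funTS].
Qed.

Let h0 z : 0 <= h z. Proof. exact: erestrict_ge0. Qed.

Lemma measurable_fun_integral_on :
  measurable_fun setT (fun x => \int[m2]_(y in D2) f x y).
Proof.
(* Only the second variable is cut off, so that the identity holds for every [x]; [h] would give 0
   for [x] outside [D1]. *)
pose g := (fun z => f z.1 z.2) \_ (setT `*` D2).
have mg : measurable_fun setT g.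
  by apply/(measurable_restrictT _ _).1; [exact: measurableX|exact: measurable_funTS].
rewrite [X in measurable_fun _ X](_ : _ = fubini_F m2 g).
  by apply: measurable_fun_fubini_tonelli_F => // z; exact: erestrict_ge0.
apply/funext => x; rewrite /fubini_F [LHS]integral_mkcond; apply: eq_integral => y _.
rewrite /g !patchE; case: ifPn => [|].
  by rewrite inE => yD; rewrite mem_set.
by move=> yD; rewrite memNset// => -[_] /=; move/mem_set; apply/negP.
Qed.

(** Extension by zero off the rectangle reduces this to Tonelli's theorem on the whole product. *)
Lemma tonelli_on : \int[m1]_(x in D1) \int[m2]_(y in D2) f x y =
  \int[m2]_(y in D2) \int[m1]_(x in D1) f x y.
Proof.
transitivity (\int[m1]_x \int[m2]_y h (x, y)).
  rewrite [LHS]integral_mkcond; apply: eq_integral => x _; rewrite patchE.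
  case: ifPn => [|/negP] xD.
    rewrite [LHS]integral_mkcond; apply: eq_integral => y _; rewrite /h !patchE.
    case: ifPn => [|/negP] yD.
      by rewrite mem_set//; split; [exact/set_mem|exact/set_mem].
    by rewrite memNset// => -[_ /mem_set].
  rewrite integral0_eq// => y _; rewrite /h patchE memNset// => -[/mem_set] //.
rewrite fubini_tonelli//; apply/esym.
rewrite [LHS]integral_mkcond; apply: eq_integral => y _; rewrite patchE.
case: ifPn => [|/negP] yD.
  rewrite [LHS]integral_mkcond; apply: eq_integral => x _; rewrite /h !patchE.
  case: ifPn => [|/negP] xD.
    by rewrite mem_set//; split; [exact/set_mem|exact/set_mem].
  by rewrite memNset// => -[/mem_set].
by rewrite integral0_eq// => x _; rewrite /h patchE memNset// => -[_ /mem_set].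
Qed.

End tonelli_on_sets.

(** * Overlap of a set with its small translates *)

Section steinhaus.
Context {R : realType}.
Local Notation mu := (@lebesgue_measure R).
Local Open Scope ereal_scope.

(** A ball of radius r around a point of [K] inside [U] leaves the margin r / 2 to all points within
    r / 2; compactness, in near-covering form, makes the margin uniform. *)
Lemma compact_open_margin (K U : set R) : compact K -> open U -> K `<=` U ->
  exists2 e : R, (0 < e)%R & forall x y, K x -> (`|x - y| < e)%R -> U y.
Proof.
move=> /compact_near_coveringP cK oU KU.
have /= := cK _ (0%R : R)^'+ (fun e x => forall y, (`|x - y| < e)%R -> U y) _.
move=> /(_ _)[].
  move=> x Kx; have /nbhs_ballP[r /= r0 rU] : nbhs x U.
    by apply: open_nbhs_nbhs; split => //; exact: KU.
  near=> x' e => /=; have er2 : (e <= r / 2)%R.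
    by near: e; apply: nbhs_right_le; rewrite divr_gt0.
  have xx' : ball x (r / 2)%R x'.
    by near: x'; apply: nbhsx_ballx; rewrite divr_gt0.
  move=> y x'y; apply: rU; rewrite /ball/=.
  rewrite -(subrK x' x) -addrA (le_lt_trans (ler_normD _ _))//.
  by rewrite (splitr r) ltrD// (lt_le_trans x'y).
move=> e /= e0 He.
(* [He] holds for positive radii strictly below [e], hence the choice of half of it. *)
exists (e / 2)%R; first by rewrite divr_gt0.
move=> x y Kx xy; apply: (He (e / 2)%R _ _ x) => //=.
- by rewrite sub0r normrN gtr0_norm ?divr_gt0// ltr_pdivrMr// mulr_natr mulr2n ltrDl.
- by rewrite divr_gt0.
Unshelve. all: by end_near. Qed.

(** Inner regularity gives [K], outer regularity an open [U] around it with excess below |K|/2. A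
    small translate of [K] stays in [U], so less than |K|/2 of it can leave [K]. *)
Lemma steinhaus (A : set R) : measurable A -> 0 < mu A ->
  exists K : set R, [/\ compact K, K `<=` A, 0 < mu K &
    exists2 e : R, (0 < e)%R & forall w : R, (0 < w < e)%R ->
      2^-1%:E * mu K <= mu (K `&` [set x | K (x + w)%R])].
Proof.
move=> mA A0.
have [_ [K [cK KA] <-] K0] : exists2 y,
    [set mu K | K in [set K | compact K /\ K `<=` A]] y & 0 < y.
  by apply: ereal_sup_gt; rewrite -lebesgue_regularity_inner_sup.
exists K; split => //.
have mK := compact_measurable cK; have Koo := compact_finite_measure cK.
have Kfin : mu K \is a fin_num by rewrite ge0_fin_numE.
have [k KE] : exists k : R, mu K = k%:E by exists (fine (mu K)); rewrite fineK.
have k0 : (0 < k)%R by rewrite -lte_fin -KE.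
have [U [oU KU UK]] := lebesgue_regularity_outer mK Koo (divr_gt0 k0 (ltr0Sn R 1)).
have [e e0 eU] := compact_open_margin cK oU KU.
exists e => // w /andP[w0 we].
pose B := [set x | K (x + w)%R].
have mB : measurable B.
  rewrite -[B]setTI.
  exact: (@measurable_funD _ _ _ setT id (cst w) _ _ measurableT K mK).
have BE : mu B = k%:E by rewrite lebesgue_measure_translation.
have : mu B <= mu (K `&` B) + mu (U `\` K).
  rewrite -(setIC B) -{1}(setUIDK B K).
  apply: (le_trans (measureU2 _ _ _)); [exact: measurableI|exact: measurableD|].
  rewrite leeD2l// le_measure// ?inE.
  - exact: measurableD.
  - by apply: measurableD => //; exact: open_measurable.
  - apply: setSD => x Bx; apply: (eU _ _ Bx).
    by rewrite addrAC subrr add0r gtr0_norm.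
rewrite BE KE => h.
have {}h : k%:E <= mu (K `&` B) + (k / 2)%:E.
  by apply: (le_trans h); rewrite leeD2l// ltW.
by move: h; rewrite -leeBlDr// -EFinB {1}(splitr k) addrK -EFinM mulrC.
Qed.

End steinhaus.

(** Reflection and translation preserve null sets. Needed for the factor of a convolution that is
    evaluated at [h - w]. *)
Lemma ae_lebesgue_reflection {R : realType} (Q : R -> Prop) (h : R) :
  {ae @lebesgue_measure R, forall x, Q x} ->
  {ae @lebesgue_measure R, forall w, Q (h - w)}.
Proof.
move=> [N [mN N0 QN]].
have mN' : measurable (-%R @^-1` N : set R).
  by rewrite -[X in measurable X]setTI; exact: (@oppr_measurable R setT measurableT N mN).
exists [set w | (-%R @^-1` N) (w + - h)]; split => /=.
- rewrite -[X in measurable X]setTI.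
  exact: (@measurable_funD _ _ _ setT id (cst (- h)) _ _ measurableT _ mN').
- rewrite (lebesgue_measure_translation (- h) mN').
  by have := lebesgue_measureN mN; rewrite N0.
- by move=> w /= Qw; rewrite opprB; exact: QN.
Qed.

(** * Measurable families of distribution functions and their derivatives *)

Section joint_measurability.
Context {R : realType}.
Local Notation mu := (@lebesgue_measure R).

(** The set where F < c is a countable union of rectangles: right-continuity finds a rational r > x
    with F t r < c, monotonicity in x gives the converse, and monotonicity in t makes the first
    sides measurable. *)
Lemma measurable_nonincreasing_right_continuous (F : R -> R -> R) :
  (forall x, nonincreasing_fun (F^~ x)) -> (forall t, nondecreasing_fun (F t)) ->
  (forall t, right_continuous (F t)) ->
  measurable_fun setT (fun z : R * R => F z.1 z.2).
Proof.
move=> Ft Fx Frc.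
apply: (measurability _ (RGenInftyO.measurableE R)) => // _ [_ [c ->] <-].
rewrite setTI [X in measurable X](_ : _ =
    \bigcup_(r : rat) ([set t | F t (ratr r) < c] `*` `]-oo, ratr r[)).
  apply: bigcupT_measurable_rat => r; apply: measurableX => //.
  rewrite -[X in measurable X]setTI (_ : [set t | _] = F^~ (ratr r) @^-1` `]-oo, c[).
    exact: (nonincreasing_measurable measurableT (Ft (ratr r))).
  by apply/seteqP; split=> t /=; rewrite in_itv.
apply/seteqP; split=> [[t x]|[t x] [r _]] /=; rewrite !in_itv/=; last first.
  by move=> [Fc xr]; rewrite (le_lt_trans _ Fc)// Fx// ltW.
move=> Fc; have : \forall y \near x^'+, F t y < c.
  by apply: (cvgr_lt _ (Frc t x)).
case=> e /= e0 He.
have xe : x < x + e by rewrite ltrDl.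
have [r] := rat_in_itvoo xe; rewrite in_itv/= => /andP[xr rxe].
exists r => //=; split; last by rewrite in_itv.
by apply: He => //=; rewrite ltr_distlC (lt_trans _ xr)//= ltrBlDr ltrDl.
Qed.

(** Lebesgue differentiation along the steps 1/(n+1): a countable family of quotients has a
    measurable upper limit. *)
Lemma ae_cvg_integral_quotient (f : R -> R) :
  mu.-integrable setT (EFin \o f) ->
  let F x := (\int[mu]_(t in `]-oo, x]) f t)%R in
  {ae mu, forall x,
    n.+1%:R * (F (x + n.+1%:R^-1) - F x) @[n --> \oo] --> f x}.
Proof.
move=> intf F.
have locf : locally_integrable setT f.
  by apply: open_integrable_locally => //; exact: openT.
have intfy y : mu.-integrable `]-oo, y] (EFin \o f).
  exact: (integrableS measurableT).
have := FTC1Ny intfy locf; rewrite -/F.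
apply: filterS; first exact: (ae_filter_ringOfSetsType mu).
move=> x [/= dF]; rewrite derive1E /derive => /= Fx.
have : h^-1 *: (F (h *: 1 + x) - F x) @[h --> 0^'] --> f x.
  by rewrite -Fx; exact: dF.
move=> /(cvgr_dnbhsP _ _ _).1 /(_ (fun n => n.+1%:R^-1)).
have nz : (forall n, (n.+1%:R^-1 : R) != 0) /\
    ((n.+1%:R^-1 : R) @[n --> \oo] --> (0 : R)).
  by split; [move=> n; rewrite invr_eq0 pnatr_eq0|exact: cvg_harmonic].
move=> /(_ nz); under eq_fun do rewrite invrK [_ *: 1]mulr1 (addrC _ x).
exact.
Qed.
End joint_measurability.

Section integral_density.
Local Open Scope ereal_scope.
Context {d : measure_display} {T : measurableType d} {R : realType}.
Variables (nu mu : {measure set T -> \bar R}) (f : T -> R).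
Hypotheses (mf : measurable_fun setT f) (f0 : forall x, (0 <= f x)%R).
Hypothesis nuE : forall A, measurable A -> nu A = \int[mu]_(x in A) (f x)%:E.

Import HBNNSimple.

(** The hypothesis [nuE] covers indicators; linearity extends it to simple functions and monotone
    convergence to [g]. *)
Lemma ge0_integral_density_mul (g : T -> \bar R) : measurable_fun setT g ->
  (forall x, 0 <= g x) -> \int[nu]_x g x = \int[mu]_x ((f x)%:E * g x).
Proof.
move=> mg g0; pose g_ := nnsfun_approx measurableT mg.
have g_g x : (g_ n x)%:E @[n --> \oo] --> g x.
  by apply: cvg_nnsfun_approx => // y _; exact: g0.
have ndg x m n : (m <= n)%N -> (g_ m x)%:E <= (g_ n x)%:E.
  by move=> mn; rewrite lee_fin; exact/lefP/nd_nnsfun_approx.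
transitivity (limn (fun n => \int[nu]_x (g_ n x)%:E)).
  rewrite -monotone_convergence//.
  - by apply: eq_integral => x _; apply/esym/cvg_lim => //; exact: g_g.
  - by move=> n; exact/measurable_EFinP.
  - by move=> n x _; rewrite lee_fin.
  - by move=> x _ m n mn; exact: ndg.
transitivity (limn (fun n => \int[mu]_x ((f x)%:E * (g_ n x)%:E))); last first.
  rewrite -monotone_convergence//.
  - apply: eq_integral => x _; apply/cvg_lim => //.
    by apply: cvgeZl => //; exact: g_g.
  - by move=> n; apply: emeasurable_funM; exact/measurable_EFinP.
  - by move=> n x _; rewrite mule_ge0 ?lee_fin.
  - by move=> x _ m n mn; apply: lee_wpmul2l; [rewrite lee_fin|exact: ndg].
congr (limn _); apply/funext => n.
have mfn r : measurable (g_ n @^-1` [set r]) by [].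
under eq_integral do rewrite fimfunE -fsumEFin//.
rewrite ge0_integral_fsum//; last 2 first.
- by move=> r; exact/measurable_EFinP/measurable_funM.
- by move=> r x _; rewrite nnfun_muleindic_ge0.
transitivity (\int[mu]_x \sum_(r \in range (g_ n))
    ((f x)%:E * (r * \1_(g_ n @^-1` [set r]) x)%:E)); last first.
  apply: eq_integral => x _; rewrite (fimfunE (g_ n) x) -fsumEFin//.
  by rewrite ge0_mule_fsumr// => r; rewrite nnfun_muleindic_ge0.
rewrite ge0_integral_fsum//; last 2 first.
- move=> r; apply: emeasurable_funM; first exact/measurable_EFinP.
  exact/measurable_EFinP/measurable_funM.
- by move=> r x _; rewrite mule_ge0 ?lee_fin// -lee_fin nnfun_muleindic_ge0.
(* Writing [r] as a value of [g_ n] shows that it is nonnegative, so it can be pulled out of the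
   integrals. *)
apply: eq_fsbigr => r; rewrite inE => -[x _ <-].
under eq_integral do rewrite EFinM.
under [RHS]eq_integral do rewrite EFinM muleCA.
rewrite !ge0_integralZl ?lee_fin//; last 3 first.
- apply: emeasurable_funM; first exact/measurable_EFinP.
  exact/measurable_EFinP.
- by move=> y _; rewrite mule_ge0 ?lee_fin.
- exact/measurable_EFinP.
congr (_ * _); rewrite integral_indic// setIT nuE// integral_mkcond.
apply: eq_integral => y _; rewrite patchE indicE.
by case: ifPn => _; rewrite ?mule1 ?mule0.
Qed.

End integral_density.

(** * Densities of a subordinator *)

Section subordinator_density.
Context {d : measure_display} {Omega : measurableType d} {R : realType}.
Variables (P : probability Omega R) (X : R -> Omega -> R) (p : R -> R -> R).
Hypotheses (XS : subordinator P X) (Xp : has_densities P X p).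
Hypothesis p_eq0 : forall t w, 0 < t -> w <= 0 -> p t w = 0.
Hypothesis p_gt0 : forall t w, 0 < t -> 0 < w -> 0 < p t w.
Local Notation mu := (@lebesgue_measure R).

Let p_ge0 t w : 0 < t -> 0 <= p t w.
Proof. by move=> t0; have [w0|w0] := leP w 0; [rewrite p_eq0|exact/ltW/p_gt0]. Qed.

Let mX t : measurable_fun setT (X t). Proof. by case: XS => -[]. Qed.

Let measurable_preX t (B : set R) : measurable B -> measurable [set w | B (X t w)].
Proof. by move=> mB; rewrite -[X in measurable X]setTI; exact: (mX t measurableT mB). Qed.

Lemma integral_density_eq1 t : 0 < t -> (\int[mu]_x (p t x)%:E = 1)%E.
Proof.
move=> t0; have [_ /(_ setT measurableT) <-] := Xp t0.
by rewrite (_ : [set _ | _] = setT) ?probability_setT//; exact/seteqP.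
Qed.

Let integrable_density t : 0 < t -> mu.-integrable setT (EFin \o p t).
Proof.
move=> t0; have [mp _] := Xp t0; apply/integrableP; split.
  exact/measurable_EFinP.
under eq_integral => x _ do rewrite /= ger0_norm ?p_ge0//.
by rewrite integral_density_eq1// ltry.
Qed.

(* The value 1 at t <= 0 keeps [subcdf ^~ x] nonincreasing on all of R. *)
Definition subcdf t x : R := if 0 < t then fine (P [set w | X t w <= x]) else 1.

Let le_measurable t x : measurable [set w | X t w <= x].
Proof.
rewrite (_ : [set _ | _] = [set w | `]-oo, x]%classic (X t w)]).
  exact: measurable_preX.
by apply/seteqP; split => w /=; rewrite in_itv.
Qed.

Lemma subcdf_nonincreasing x : nonincreasing_fun (subcdf ^~ x).
Proof.
move=> s t st; rewrite /subcdf.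
have [s0|s0] := ltP 0 s; last first.
  case: ifPn => // _; rewrite -lee_fin fineK ?fin_num_measure//.
  exact: probability_le1.
rewrite (lt_le_trans s0 st) fine_le ?fin_num_measure//.
(* Off the null set [N] paths are nondecreasing, so X_t <= x forces X_s <= x. *)
case: XS => _ [N [mN N0 XN]].
have NE : P ([set w | X s w <= x] `|` N) = P [set w | X s w <= x].
  by rewrite measureU0.
rewrite -NE le_measure ?inE//; first exact: measurableU.
move=> w /= Xt; have [Nw|Nw] := pselect (N w); first by right.
left; apply: le_trans Xt.
by have /contrapT := contra_not (XN w) Nw; apply => //; exact: ltW.
Qed.

Lemma subcdf_nondecreasing t : nondecreasing_fun (subcdf t).
Proof.
move=> x y xy; rewrite /subcdf; case: ifPn => // t0.
rewrite fine_le ?fin_num_measure// le_measure ?inE//.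
by move=> w /= Xx; exact: le_trans xy.
Qed.

Lemma subcdfE t x : 0 < t -> subcdf t x = (\int[mu]_(y in `]-oo, x]) p t y)%R.
Proof.
move=> t0; rewrite /subcdf t0 /Rintegral; congr fine.
have [_ /(_ `]-oo, x]%classic) <-//] := Xp t0.
Qed.

Lemma subcdf_right_continuous t : right_continuous (subcdf t).
Proof.
move=> x; rewrite /subcdf; case: ifPn => t0; last exact: cvg_cst.
pose Xt : {RV P >-> R} := HB.pack (X t) (isMeasurableFun.Build _ _ _ _ _ (mX t)).
have E y : P [set w | X t w <= y] = cdf Xt y.
  by rewrite /cdf; congr (P _); apply/seteqP; split => w /=; rewrite in_itv.
apply: fine_cvg; rewrite fineK ?fin_num_measure// E.
by under eq_fun do rewrite E; exact: cdf_right_continuous.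
Qed.

(* A version of the density of X_t that is jointly measurable in (t, x).  It
   vanishes for t <= 0, where [subcdf t] is constant. *)
Definition subdens t x : R := if 0 < x then
  Num.max 0 (fine (limn_esup (fun n =>
    (n.+1%:R * (subcdf t (x + n.+1%:R^-1) - subcdf t x))%:E))) else 0.

Lemma subdens_ge0 t x : 0 <= subdens t x.
Proof. by rewrite /subdens; case: ifPn => // _; rewrite le_max lexx. Qed.

Lemma subdens_eq0 t x : x <= 0 -> subdens t x = 0.
Proof. by rewrite /subdens; case: ltP. Qed.

Lemma measurable_subdens : measurable_fun setT (fun z : R * R => subdens z.1 z.2).
Proof.
have mF := measurable_nonincreasing_right_continuous subcdf_nonincreasing
  subcdf_nondecreasing subcdf_right_continuous.
apply: measurable_fun_ifT => //; first exact: measurable_fun_ltr.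
apply: measurable_maxr => //.
apply: (measurableT_comp (fine_measurable measurableT)).
apply: (measurable_fun_limn_esup (f := fun n (z : R * R) => _)) => n.
apply/measurable_EFinP; apply: measurable_funM => //; apply: measurable_funB => //.
apply: (@measurableT_comp _ _ _ _ _ _ (fun z : R * R => subcdf z.1 z.2) _
  (fun z : R * R => (z.1, z.2 + n.+1%:R^-1))) => //.
by apply: measurable_fun_pair => //; exact: measurable_funD.
Qed.

Lemma subdens_time_le0 t x : t <= 0 -> subdens t x = 0.
Proof.
move=> t0; rewrite /subdens; case: ifPn => // _.
rewrite /subcdf ltNge t0/= subrr.
under eq_fun do rewrite mulr0.
by rewrite (cvg_limn_einf_sup (@cvg_cst _ _ _ _ _)).2/= maxxx.
Qed.

(** Where the quotients converge, their upper limit is p_t(x); the positive part and the cutoff at 0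
    do not change it, because p_t is nonnegative and vanishes on the nonpositive half-line. *)
Lemma ae_subdens t : 0 < t -> {ae mu, forall x, subdens t x = p t x}.
Proof.
move=> t0; have := ae_cvg_integral_quotient (integrable_density t0).
apply: filterS; first exact: (ae_filter_ringOfSetsType mu).
move=> x /= h; rewrite /subdens; have [x0|x0] := leP x 0; first by rewrite p_eq0.
have {}h : (n.+1%:R * (subcdf t (x + n.+1%:R^-1) - subcdf t x))%:E @[n --> \oo]
    --> (p t x)%:E.
  by under eq_fun do rewrite !subcdfE//; apply: cvg_EFin; [exact: nearW|exact: h].
by rewrite (cvg_limn_einf_sup h).2/= max_r// p_ge0.
Qed.

(** * Successive increments and convolution of densities *)

Let measurable_preincr s t (B : set R) : measurable B ->
  measurable [set w | B (incr X s t w)].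
Proof.
move=> mB; rewrite -[X in measurable X]setTI.
by apply: (measurable_funB (mX t) (mX s)).
Qed.

Let X0_ae0 : {ae P, forall w, X 0 w = 0}. Proof. by case: XS => -[]. Qed.

Let law_incr0 t (B : set R) : measurable B ->
  P [set w | B (incr X 0 t w)] = P [set w | B (X t w)].
Proof.
move=> mB; apply: eq_measure_ae; [exact: measurable_preincr|exact: measurable_preX|].
apply: filterS X0_ae0 => w /= X0w.
by rewrite /incr X0w subr0.
Qed.

(** The increments over the partition 0 < a < a + b are independent. The first is almost surely
    [X a], as [X 0] vanishes almost surely, and by stationarity the second has the law of [X b]. *)
Lemma law_increments a b (A B : set R) : 0 < a -> 0 < b ->
  measurable A -> measurable B ->
  P [set w | A (X a w) /\ B (incr X a (a + b) w)] =
  (P [set w | A (X a w)] * P [set w | B (X b w)])%E.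
Proof.
move=> a0 b0 mA mB; have [[_ _ [ind sta] _ _] _] := XS.
pose u n : R := if n == 0%N then 0 else if n == 1%N then a else a + b.
pose C n : set R := if n == 0%N then A else B.
have uS i : (i < 2)%N -> u i < u i.+1 by case: i => [|[|]]//= _; rewrite ltrDl.
have mC i : measurable (C i) by case: i.
have := ind 2%N u C (lexx _) uS mC.
rewrite big_ord_recl big_ord1/= /u/= /C/=.
rewrite (law_incr0 _ mA) => indE.
have <- : P [set w | B (incr X a (a + b) w)] = P [set w | B (X b w)].
  by rewrite sta// ?lerDl ?(ltW a0) ?(ltW b0)// (addrC a) addrK law_incr0.
rewrite -{}indE.
apply: eq_measure_ae.
- apply: measurableI; [exact: measurable_preX|exact: measurable_preincr].
- apply: bigcap_measurableType => -[|[|k]] _//=; exact: measurable_preincr.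
apply: filterS X0_ae0 => w /= X0w; split.
  by move=> [Aw Bw] [|[|k]] //= _; rewrite /incr X0w subr0.
by move=> h; have := h 0%N isT; have /= := h 1%N isT; rewrite /incr/= X0w subr0.
Qed.

Let Xrv t : {mfun Omega >-> measurableTypeR R} :=
  HB.pack (X t) (isMeasurableFun.Build _ _ _ (measurableTypeR R) _ (mX t)).

(** Both sides agree on rectangles, and these determine the product measure. *)
Lemma law_increment_pair a b (S : set (measurableTypeR R * measurableTypeR R)) :
  0 < a -> 0 < b -> measurable S ->
  P [set w | S (X a w, incr X a (a + b) w)] =
  (distribution P (Xrv a) \x distribution P (Xrv b))%E S.
Proof.
move=> a0 b0 mS.
have mi : measurable_fun setT (incr X a (a + b)) by exact: measurable_funB.
have mpair : measurable_fun setT (fun w => (X a w, incr X a (a + b) w)).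
  exact: measurable_fun_pair.
pose Z : {mfun Omega >-> (measurableTypeR R * measurableTypeR R)%type} :=
  HB.pack (fun w => (X a w, incr X a (a + b) w))
    (isMeasurableFun.Build _ _ _ (measurableTypeR R * measurableTypeR R)%type _ mpair).
rewrite (product_measure_unique (m' := distribution P Z))//.
by move=> A B mA mB; exact: law_increments.
Qed.

Lemma measurable_subdens1 t : measurable_fun setT (subdens t).
Proof.
apply: (@measurableT_comp _ _ _ _ _ _ (fun z : R * R => subdens z.1 z.2) _
  (fun x : R => (t, x))); first exact: measurable_subdens.
exact: measurable_fun_pair.
Qed.

Let measurable_subdens_shift t x : measurable_fun setT (fun h : R => subdens t (h - x)).
Proof.
by apply: (measurableT_comp (measurable_subdens1 t)); exact: measurable_funB.
Qed.

Let law_density t (B : set R) : 0 < t -> measurable B ->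
  P [set w | B (X t w)] = (\int[mu]_(x in B) (subdens t x)%:E)%E.
Proof.
move=> t0 mB; have [mp ->//] := Xp t0.
apply: ge0_ae_eq_integral => //.
- exact/measurable_EFinP/measurable_funTS.
- by apply/measurable_EFinP/measurable_funTS; exact: measurable_subdens1.
- by move=> x _; rewrite lee_fin p_ge0.
- by move=> x _; rewrite lee_fin subdens_ge0.
apply: filterS (ae_subdens t0); first exact: (ae_filter_ringOfSetsType mu).
by move=> x /= ->.
Qed.

(** Both sides equal P(0 < X_{a+b} < e), with X_{a+b} split at time a. Integrating over [h] avoids
    the null sets on which densities are ambiguous. *)
Lemma chapman_kolmogorov a b e : 0 < a -> 0 < b ->
  (\int[mu]_(h in `]0%R, e[) \int[mu]_w (subdens a w * subdens b (h - w))%:E =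
   \int[mu]_(h in `]0%R, e[) (p (a + b) h)%:E)%E.
Proof.
move=> a0 b0; have [_ <-//] := Xp (addr_gt0 a0 b0).
pose S : set (measurableTypeR R * measurableTypeR R) :=
  [set z : R * R | `]0%R, e[%classic (z.1 + z.2)].
have mS : measurable S.
  rewrite -[S]setTI.
  exact: (measurable_funD measurable_fst measurable_snd measurableT).
transitivity (P [set w | S (X a w, incr X a (a + b) w)]); last first.
  by congr (P _); apply/seteqP; split => w; rewrite /S /incr /= (addrC (X a w)) subrK.
rewrite law_increment_pair// /product_measure1.
have mdist t : measurable_fun setT (distribution P (Xrv t) \o xsection S).
  exact: measurable_fun_xsection.
have distE A : measurable A -> distribution P (Xrv a) A =
    (\int[mu]_(x in A) (subdens a x)%:E)%E.
  by move=> mA; rewrite -law_density.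
have := @ge0_integral_density_mul _ (measurableTypeR R) R (distribution P (Xrv a)) mu _
  (measurable_subdens1 a) (subdens_ge0 a) distE _ (mdist b).
move=> -> //.
rewrite tonelli_on//; last 2 first.
- apply/measurable_EFinP; apply: measurable_funM.
    exact: (measurableT_comp (measurable_subdens1 a)).
  apply: (measurableT_comp (measurable_subdens1 b)).
  exact: measurable_funB.
- by move=> x y; rewrite lee_fin mulr_ge0 ?subdens_ge0.
apply: eq_integral => x _.
under eq_integral do rewrite EFinM.
rewrite ge0_integralZl//; last 3 first.
- by apply/measurable_EFinP/measurable_funTS; exact: measurable_subdens_shift.
- by move=> h _; rewrite lee_fin subdens_ge0.
- by rewrite lee_fin subdens_ge0.
congr (_ * _)%E; rewrite /distribution /pushforward/=.
rewrite [RHS](law_density b0); last exact: measurable_xsection.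
(* The section of [S] at x is the interval (0, e) shifted by -x, which the substitution h = v + x
   undoes. *)
rewrite integral_mkcond [RHS]integral_mkcond.
rewrite -(ge0_integral_translation x); last 2 first.
- apply/(measurable_restrictT _ _).1 => //.
  by apply/measurable_EFinP/measurable_funTS; exact: measurable_subdens_shift.
- by move=> h; apply: erestrict_ge0 => y _; rewrite lee_fin subdens_ge0.
apply: eq_integral => v _; rewrite !patchE addrK; congr (if _ then _ else _).
by rewrite mem_xsection /S; apply/idP/idP; rewrite !inE/= addrC.
Qed.

(** Substitute z = x + w, then replace each [p] by [subdens]: for fixed times they agree for almost
    every w. *)
Lemma integral_bridgeE (q : R -> \bar R) s t u x h :
  measurable_fun setT q -> (forall z, 0 <= q z)%E ->
  s < t -> s <= u <= t -> 0 < h ->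
  (\int[mu]_z ((trans_dens p s x u z * trans_dens p u z t (x + h)
    / trans_dens p s x t (x + h))%R%:E * q z) =
   (p (t - s) h)^-1%:E *
   \int[mu]_w ((subdens (u - s) w * subdens (t - u) (h - w))%:E * q (x + w)%R))%E.
Proof.
move=> mq q0 st /andP[+ +] h0.
rewrite /trans_dens st (addrC x h) addrK.
have ph0 : 0 <= (p (t - s) h)^-1 by rewrite invr_ge0 p_ge0// subr_gt0.
(* At the endpoints u = s and u = t both sides are 0, by the default of [trans_dens] at equal times
   and the vanishing of [subdens] at time 0. *)
rewrite le_eqVlt => /predU1P[<- _|su].
  rewrite subrr ltxx !integral0_eq ?mule0// => z _.
    by rewrite subdens_time_le0// mul0r mul0e.
  by rewrite !mul0r mul0e.
rewrite su le_eqVlt => /predU1P[->|ut].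
  rewrite subrr ltxx !integral0_eq ?mule0// => z _.
    by rewrite (@subdens_time_le0 0)// mulr0 mul0e.
  by rewrite mulr0 mul0r mul0e.
rewrite ut.
have us0 : 0 < u - s by rewrite subr_gt0.
have tu0 : 0 < t - u by rewrite subr_gt0.
have [mp1 _] := Xp us0; have [mp2 _] := Xp tu0.
have mqx : measurable_fun setT (fun w : R => q (x + w)).
  by apply: (measurableT_comp mq); exact: measurable_funD.
rewrite -(ge0_integral_translation x); last 2 first.
- apply: emeasurable_funM => //; apply/measurable_EFinP.
  apply: measurable_funM => //; apply: measurable_funM.
    by apply: (measurableT_comp mp1); exact: measurable_funB.
  by apply: (measurableT_comp mp2); exact: measurable_funB.
- by move=> z; rewrite mule_ge0// lee_fin !mulr_ge0// ?p_ge0.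
have mpp : measurable_fun setT (fun w : R => p (u - s) w * p (t - u) (h - w)).
  apply: measurable_funM => //.
  by apply: (measurableT_comp mp2); exact: measurable_funB.
have msd : measurable_fun setT
    (fun w : R => subdens (u - s) w * subdens (t - u) (h - w)).
  apply: measurable_funM; first exact: measurable_subdens1.
  apply: (measurableT_comp (measurable_subdens1 (t - u))).
  exact: measurable_funB.
transitivity (\int[mu]_w ((p (t - s) h)^-1%:E *
    ((p (u - s) w * p (t - u) (h - w))%:E * q (x + w)%R)))%E.
  apply: eq_integral => w _.
  rewrite addrK opprD addrACA subrr addr0 (addrC w x) muleA -EFinM.
  by rewrite mulrC.
rewrite ge0_integralZl//; last 2 first.
- by apply: emeasurable_funM => //; exact/measurable_EFinP.
- by move=> w _; rewrite mule_ge0// lee_fin mulr_ge0// p_ge0.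
congr (_ * _)%E; apply: ge0_ae_eq_integral => //.
- by apply: emeasurable_funM => //; exact/measurable_EFinP.
- by apply: emeasurable_funM => //; exact/measurable_EFinP.
- by move=> w _; rewrite mule_ge0// lee_fin mulr_ge0// p_ge0.
- by move=> w _; rewrite mule_ge0// lee_fin mulr_ge0// subdens_ge0.
have := ae_lebesgue_reflection h (ae_subdens tu0); have := ae_subdens us0.
apply: filterS2; first exact: (ae_filter_ringOfSetsType mu).
by move=> w /= -> ->.
Qed.

End subordinator_density.

(** * The upper bound *)

Section bridge_average_bound.
Context {R : realType}.
Local Notation mu := (@lebesgue_measure R).
Variables (g : R -> R -> R) (r : R -> R) (q : R -> \bar R) (s t C : R).
Hypotheses (mg : measurable_fun setT (fun z : R * R => g z.1 z.2)).
Hypotheses (g_ge0 : forall a w, 0 <= g a w).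
Hypotheses (g_eq0 : forall a w, w <= 0 -> g a w = 0).
Hypotheses (mr : measurable_fun setT r) (r_gt0 : forall h, 0 < h -> 0 < r h).
Hypothesis r_lty : forall e, (\int[mu]_(h in `]0%R, e[) (r h)%:E < +oo)%E.
Hypotheses (mq : measurable_fun setT q) (q_ge0 : forall x, (0 <= q x)%E).
Hypotheses (st : s < t) (C_ge0 : 0 <= C).
Local Open Scope ereal_scope.
Hypothesis convE : forall u e, (s < u < t)%R ->
  \int[mu]_(h in `]0%R, e[) \int[mu]_w (g (u - s) w * g (t - u) (h - w))%:E =
  \int[mu]_(h in `]0%R, e[) (r h)%:E.
Hypothesis bridge_le : forall x h, (0 < h)%R ->
  \int[mu]_(u in `[s, t]) \int[mu]_w
    ((g (u - s) w * g (t - u) (h - w))%:E * q (x + w)%R) <= C%:E * (r h)%:E.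

(** Divided by [r h], this plays the role of the density at time u of the bridge from 0 at time s to
    h at time t. *)
Let k u h w : R := (g (u - s) w * g (t - u) (h - w))%R.

Let k_ge0 u h w : (0 <= k u h w)%R. Proof. by rewrite mulr_ge0. Qed.

(** The arguments are functions of a common parameter, so that one statement serves every order of
    integration. *)
Lemma measurable_bridge_kernel {d : measure_display} {T : measurableType d}
    (u h w : T -> R) :
  measurable_fun setT u -> measurable_fun setT h -> measurable_fun setT w ->
  measurable_fun setT (fun z => (g (u z - s) (w z) * g (t - u z) (h z - w z))%R).
Proof.
move=> mu_ mh mw; apply: measurable_funM.
  apply: (@measurableT_comp _ _ _ _ _ _ (fun z : R * R => g z.1 z.2) _
    (fun z => ((u z - s)%R, w z))) => //.
  by apply: measurable_fun_pair => //; exact: measurable_funB.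
apply: (@measurableT_comp _ _ _ _ _ _ (fun z : R * R => g z.1 z.2) _
  (fun z => ((t - u z)%R, (h z - w z)%R))) => //.
by apply: measurable_fun_pair => //; exact: measurable_funB.
Qed.

Lemma measurable_bridge_integral (x h : R) : measurable_fun setT (fun u : R =>
  \int[mu]_w ((g (u - s) w * g (t - u) (h - w))%:E * q (x + w)%R)).
Proof.
apply: (measurable_fun_integral_on mu
    (f := fun u w => (k u h w)%:E * q (x + w)%R)) => //; last first.
  by move=> u w; rewrite mule_ge0 ?lee_fin.
apply: emeasurable_funM.
  by apply/measurable_EFinP; exact: measurable_bridge_kernel.
by apply: (measurableT_comp mq); exact: measurable_funD.
Qed.

(** * Averaging the starting point over a set where [q] is at least [M] *)

Section average_over_set.
Variables (K : set R) (M e : R).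
Hypotheses (mK : measurable K) (M_ge0 : (0 <= M)%R).
Hypothesis qK : forall x, K x -> M%:E <= q x.

(** Multiplied by [M], this minorises the integrand in [bridge_le], since [qK] bounds [q] below on
    [K]. *)
Let phi x u h w : \bar R := (k u h w * \1_K (x + w)%R)%:E.

Let phi_ge0 x u h w : 0 <= phi x u h w.
Proof. by rewrite lee_fin mulr_ge0. Qed.

Let measurable_phi {d : measure_display} {T : measurableType d} (x u h w : T -> R) :
  measurable_fun setT x -> measurable_fun setT u -> measurable_fun setT h ->
  measurable_fun setT w ->
  measurable_fun setT (fun z => phi (x z) (u z) (h z) (w z)).
Proof.
move=> mx mu_ mh mw; apply/measurable_EFinP; apply: measurable_funM.
  exact: measurable_bridge_kernel.
apply: (@measurableT_comp _ _ _ _ _ _ (\1_K : R -> R)); first exact: measurable_indic.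
exact: measurable_funD.
Qed.

Lemma bridge_indic_le x h : (0 < h)%R ->
  M%:E * \int[mu]_(u in `[s, t]) \int[mu]_w phi x u h w <= C%:E * (r h)%:E.
Proof.
move=> h0; apply: le_trans (bridge_le x h0).
rewrite -ge0_integralZl//; last 2 first.
- apply: measurable_funTS; apply: measurable_fun_integral_on => //.
  exact: measurable_phi.
- by move=> u _; exact: integral_ge0.
apply: ge0_le_integral => //.
- by move=> u _; rewrite mule_ge0 ?lee_fin//; exact: integral_ge0.
- apply: measurable_funTS; apply: emeasurable_funM => //.
  apply: measurable_fun_integral_on => //.
  exact: measurable_phi.
- by apply: measurable_funTS; exact: measurable_bridge_integral.
move=> u _; rewrite -ge0_integralZl//; last exact: measurable_phi.
apply: ge0_le_integral => //.
- by move=> w _; apply: mule_ge0; [rewrite lee_fin|exact: phi_ge0].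
- by apply: emeasurable_funM => //; exact: measurable_phi.
- apply: emeasurable_funM; first exact/measurable_EFinP/measurable_bridge_kernel.
  by apply: (measurableT_comp mq); exact: measurable_funD.
move=> w _; rewrite /phi EFinM muleCA lee_wpmul2l ?lee_fin//.
rewrite indicE; have [|_] := boolP (_ \in K); last by rewrite mule0.
by rewrite inE => Kxw; rewrite mule1 qK.
Qed.

Hypothesis K_overlap : forall w, (0 < w < e)%R ->
  2^-1%:E * mu K <= mu (K `&` [set x | K (x + w)%R]).

(** Integrate [bridge_indic_le] over x in [K]. For fixed w the indicator integrates to the overlap
    of [K] with its translate, at least |K|/2 whenever the kernel is nonzero. *)
Lemma bridge_mass_le h : (0 < h < e)%R ->
  M%:E * (2^-1%:E * mu K * \int[mu]_(u in `[s, t]) \int[mu]_w (k u h w)%:E) <=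
  C%:E * mu K * (r h)%:E.
Proof.
move=> /andP[h0 he].
have mI : measurable_fun setT (fun z : R * R => \int[mu]_w phi z.1 z.2 h w).
  apply: (measurable_fun_integral_on mu (f := fun z w => phi z.1 z.2 h w)) => //.
  apply: measurable_phi => //.
  + exact: (measurableT_comp measurable_fst).
  + exact: (measurableT_comp measurable_snd).
apply: (@le_trans _ _ (\int[mu]_(x in K) (C%:E * (r h)%:E))); last first.
  by rewrite integral_cst// muleAC.
apply: (@le_trans _ _ (\int[mu]_(x in K)
    (M%:E * \int[mu]_(u in `[s, t]) \int[mu]_w phi x u h w))); last first.
  apply: ge0_le_integral => //.
  - move=> x _; apply: mule_ge0; first by rewrite lee_fin.
    by apply: integral_ge0 => u _; exact: integral_ge0.
  - apply: measurable_funTS; apply: emeasurable_funM => //.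
    apply: (measurable_fun_integral_on mu (f := fun x u => \int[mu]_w phi x u h w)) => //.
    by move=> x u; exact: integral_ge0.
  - by move=> x _; exact: bridge_indic_le.
rewrite ge0_integralZl//; last 2 first.
- apply: measurable_funTS.
  apply: (measurable_fun_integral_on mu (f := fun x u => \int[mu]_w phi x u h w)) => //.
  by move=> x u; exact: integral_ge0.
- by move=> x _; apply: integral_ge0 => u _; exact: integral_ge0.
(* Two exchanges, this one and another below for fixed [u], bring the integral over x innermost. *)
rewrite lee_wpmul2l ?lee_fin// [leRHS]tonelli_on//; last first.
  by move=> x u; exact: integral_ge0.
have mk u : measurable_fun setT (fun w => (k u h w)%:E).
  by apply/measurable_EFinP; exact: measurable_bridge_kernel.
have mIk : measurable_fun setT (fun u => \int[mu]_w (k u h w)%:E).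
  apply: (measurable_fun_integral_on mu (f := fun u w => (k u h w)%:E)) => //.
    by apply/measurable_EFinP; exact: measurable_bridge_kernel.
  by move=> u w; rewrite lee_fin.
rewrite -ge0_integralZl//; last 3 first.
- exact: measurable_funTS.
- by move=> u _; apply: integral_ge0 => w _; rewrite lee_fin.
- by rewrite mule_ge0// lee_fin invr_ge0.
apply: ge0_le_integral => //.
- move=> u _; apply: mule_ge0; first by rewrite mule_ge0// lee_fin invr_ge0.
  by apply: integral_ge0 => w _; rewrite lee_fin.
- by apply: measurable_funTS; apply: emeasurable_funM.
- apply: measurable_funTS.
  apply: (measurable_fun_integral_on mu (f := fun u x => \int[mu]_w phi x u h w)) => //.
    apply: (measurable_fun_integral_on mu (f := fun z w => phi z.2 z.1 h w)) => //.
    apply: measurable_phi => //.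
    + exact: (measurableT_comp measurable_snd).
    + exact: (measurableT_comp measurable_fst).
  by move=> u x; exact: integral_ge0.
move=> u _; rewrite tonelli_on//; last exact: measurable_phi.
rewrite -ge0_integralZl//; last 3 first.
- exact: mk.
- by move=> w _; rewrite lee_fin.
- by rewrite mule_ge0// lee_fin invr_ge0.
apply: ge0_le_integral => //.
- move=> w _; apply: mule_ge0; last by rewrite lee_fin.
  by rewrite mule_ge0// lee_fin invr_ge0.
- by apply: emeasurable_funM; [exact: measurable_cst|exact: mk].
- apply: (measurable_fun_integral_on mu (f := fun w x => phi x u h w)) => //.
  exact: measurable_phi.
move=> w _; rewrite /phi.
have E x : \1_K (x + w)%R = \1_[set x | K (x + w)%R] x :> R.
  by rewrite !indicE; congr (_%:R)%R; apply/idP/idP; rewrite !inE.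
have mKw : measurable [set x | K (x + w)%R].
  rewrite -[X in measurable X]setTI.
  exact: (@measurable_funD _ _ _ setT id (cst w) _ _ measurableT K mK).
under eq_integral do rewrite E.
under eq_integral do rewrite EFinM.
rewrite ge0_integralZl//; last 2 first.
- exact/measurable_EFinP/measurable_indic.
- by rewrite lee_fin.
(* Inside (0, h), w is below [e] and the overlap bound applies; outside, one factor of [k] has a
   nonpositive argument and vanishes. *)
have [/andP[w0 wh]|] := boolP (0 < w < h)%R.
  rewrite muleC lee_wpmul2l ?lee_fin//.
  have we : (0 < w < e)%R by rewrite w0 (lt_trans wh).
  by rewrite (le_trans (K_overlap we))// integral_indic// setIC.
rewrite negb_and -!leNgt => wh.
rewrite (_ : k u h w = 0%R) ?mule0 ?mul0e//.
rewrite /k; case/orP: wh => [w0|hw]; first by rewrite g_eq0// mul0r.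
by rewrite (g_eq0 (t - u))// ?mulr0// subr_le0.
Qed.

End average_over_set.
Theorem ess_sup_le_bridge_bound : ess_sup mu q <= (2 * C / (t - s) + 1)%:E.
Proof.
(* The summand 1 makes [M] strictly exceed 2C/(t-s), so that a single level [M] gives a
   contradiction. *)
set M := (2 * C / (t - s) + 1)%R.
have ts0 : (0 < t - s)%R by rewrite subr_gt0.
have M0 : (0 <= M)%R by rewrite addr_ge0// divr_ge0 ?mulr_ge0// ltW.
apply/ess_supP/ae_le_measureP => //; apply/eqP; apply: contraT => A0.
have mA : measurable (q @^-1` `]M%:E, +oo[).
  by rewrite -[X in measurable X]setTI; apply: mq => //; exact: emeasurable_itv.
have {}A0 : 0 < mu (q @^-1` `]M%:E, +oo[) by rewrite lt0e A0/=.
have [K [cK KA K0 [e e0 Ke]]] := steinhaus mA A0.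
have mK := compact_measurable cK; have Koo := compact_finite_measure cK.
have qK x : K x -> M%:E <= q x.
  by move=> /KA/=; rewrite in_itv/= andbT => /ltW.
have r_ge0 h : (0 < h)%R -> 0 <= (r h)%:E by move=> h0; rewrite lee_fin ltW// r_gt0.
set pi := \int[mu]_(h in `]0%R, e[) (r h)%:E.
(* If [pi] were 0, the positive function [r] would vanish almost everywhere on (0, e), making this
   interval null. *)
have pi0 : 0 < pi.
  rewrite lt0e integral_ge0 ?andbT; last first.
    by move=> h /=; rewrite in_itv/= => /andP[h0 _]; exact: r_ge0.
  apply/negP => /eqP pi0.
  have : \int[mu]_(h in `]0%R, e[) `|(r h)%:E| = 0.
    rewrite -[RHS]pi0; apply: eq_integral => h; rewrite inE/= in_itv/= => /andP[h0 _].
    by rewrite ger0_norm// ltW// r_gt0.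
  move/(ae_eq_integral_abs mu); case.
  - exact: measurable_itv.
  - exact/measurable_EFinP/measurable_funTS.
  move=> N [mN N0 rN].
  have : mu `]0%R, e[ <= mu N.
    rewrite le_measure ?inE// => h /= he; apply: rN => /= /(_ he) [] rh.
    by move: he; rewrite in_itv/= => /andP[/r_gt0]; rewrite rh ltxx.
  by rewrite N0 lebesgue_measure_itv/= lte_fin e0 oppr0 adde0 lee_fin leNgt e0.
have mIk : measurable_fun setT
    (fun z : R * R => \int[mu]_w (k z.2 z.1 w)%:E).
  apply: (measurable_fun_integral_on mu (f := fun z w => (k z.2 z.1 w)%:E)) => //.
    apply/measurable_EFinP; apply: measurable_bridge_kernel => //.
    + exact: (measurableT_comp measurable_snd).
    + exact: (measurableT_comp measurable_fst).
  by move=> z w; rewrite lee_fin.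
have Ik0 u h : 0 <= \int[mu]_w (k u h w)%:E.
  by apply: integral_ge0 => w _; rewrite lee_fin.
have mIIk : measurable_fun setT
    (fun h => \int[mu]_(u in `[s, t]) \int[mu]_w (k u h w)%:E).
  exact: (measurable_fun_integral_on mu (f := fun h u => \int[mu]_w (k u h w)%:E)).
(* [convE] holds only for u strictly between s and t, so the integral is computed on the open
   interval and then enlarged to the closed one. *)
have massE : (t - s)%:E * pi <=
    \int[mu]_(h in `]0%R, e[) \int[mu]_(u in `[s, t]) \int[mu]_w (k u h w)%:E.
  rewrite tonelli_on//.
  apply: (@le_trans _ _ (\int[mu]_(u in `]s, t[) pi)).
    by rewrite integral_cst//= lebesgue_measure_itv/= lte_fin st -EFinB muleC.
  have mJ : measurable_fun setT
      (fun u => \int[mu]_(h in `]0%R, e[) \int[mu]_w (k u h w)%:E).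
    apply: (measurable_fun_integral_on mu (f := fun u h => \int[mu]_w (k u h w)%:E)) => //.
    apply: (measurable_fun_integral_on mu (f := fun z w => (k z.1 z.2 w)%:E)) => //.
      apply/measurable_EFinP; apply: measurable_bridge_kernel => //.
      + exact: (measurableT_comp measurable_fst).
      + exact: (measurableT_comp measurable_snd).
    by move=> z w; rewrite lee_fin.
  have -> : \int[mu]_(u in `]s, t[) pi =
      \int[mu]_(u in `]s, t[) \int[mu]_(h in `]0%R, e[) \int[mu]_w (k u h w)%:E.
    by apply: eq_integral => u; rewrite inE/= in_itv/= => sut; rewrite convE.
  apply: ge0_subset_integral => //.
  - exact: measurable_funTS.
  - by move=> u _; apply: integral_ge0.
  - by apply: subset_itv; rewrite bnd_simp.
have : M%:E * (2^-1%:E * mu K * ((t - s)%:E * pi)) <= C%:E * mu K * pi.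
  have hK0 : 0 <= 2^-1%:E * mu K by rewrite mule_ge0// lee_fin invr_ge0.
  apply: (@le_trans _ _ (\int[mu]_(h in `]0%R, e[) (M%:E * (2^-1%:E * mu K *
      \int[mu]_(u in `[s, t]) \int[mu]_w (k u h w)%:E)))).
    rewrite ge0_integralZl//; last 2 first.
    - by apply: measurable_funTS; apply: emeasurable_funM.
    - by move=> h _; apply: mule_ge0 => //; apply: integral_ge0.
    rewrite ge0_integralZl//; last 2 first.
    - exact: measurable_funTS.
    - by move=> h _; apply: integral_ge0.
    by rewrite lee_wpmul2l ?lee_fin// lee_wpmul2l.
  rewrite -ge0_integralZl//; last 3 first.
  - exact/measurable_EFinP/measurable_funTS.
  - by move=> h /=; rewrite in_itv/= => /andP[h0 _]; exact: r_ge0.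
  - by rewrite mule_ge0// lee_fin.
  apply: ge0_le_integral => //.
  - move=> h _; rewrite mule_ge0 ?lee_fin// mule_ge0//; exact: integral_ge0.
  - by apply: measurable_funTS; do 2 apply: emeasurable_funM => //.
  - apply: measurable_funTS; apply: emeasurable_funM => //.
    exact/measurable_EFinP.
  - move=> h /=; rewrite in_itv/= => he.
    exact: (bridge_mass_le mK M0 qK Ke).
have [kap KE] : exists x : R, mu K = x%:E.
  by exists (fine (mu K)); rewrite fineK// ge0_fin_numE.
have [vpi piE] : exists x : R, pi = x%:E.
  by exists (fine pi); rewrite fineK// ge0_fin_numE ?r_lty// ltW.
move: K0 pi0; rewrite KE piE !lte_fin => kap0 pi0.
rewrite -!EFinM lee_fin leNgt => /negP; case.
(* Cancelling |K| and [pi] leaves M(t-s)/2 <= C, whereas M(t-s)/2 = C + (t-s)/2. *)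
rewrite -mulrA (mulrC _ (kap * vpi)%R).
rewrite (_ : (M * _)%R = ((kap * vpi) * (M * (t - s) / 2))%R); last by ring.
rewrite ltr_pM2l ?mulr_gt0// ltr_pdivlMr// /M mulrDl mul1r divfK ?gt_eqF//.
by rewrite mulrC ltrDl.
Qed.

End bridge_average_bound.

(** * Essential boundedness of [q] *)

Unset Implicit Arguments.
Set Strict Implicit.
Set Printing Implicit Defensive.

Theorem theorem3p3 (R : realType) (d : measure_display) (Omega : measurableType d)
  (P : probability Omega R) (X : R -> Omega -> R) (p : R -> R -> R)
  (q : R -> \bar R) :
  subordinator P X ->
  has_densities P X p ->
  (forall s x t y, (t <= s \/ y <= x) -> trans_dens p s x t y = 0) ->
  (forall s x t y, s < t -> x < y -> 0 < trans_dens p s x t y) ->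
  measurable_fun [set: R] q ->
  (forall z, (0 <= q z)%E) ->
  (exists s t : R, s < t /\
     (ereal_sup [set v | exists x y : R, (x < y)%R /\ v =
        \int[lebesgue_measure]_(u in `[s, t])
          \int[lebesgue_measure]_(z in setT)
            ((trans_dens p s x u z * trans_dens p u z t y
              / trans_dens p s x t y)%R%:E * q z)] < +oo)%E) ->
  (ess_sup lebesgue_measure q < +oo)%E.
Proof.
move=> XS Xp p0 ppos mq q0 [s [t [st]]]; set V := [set v | _]; set C := ereal_sup V.
move=> Coo.
have p_eq0 a w : 0 < a -> w <= 0 -> p a w = 0.
  move=> a0 w0; have := p0 0 0 a w (or_intror w0).
  by rewrite /trans_dens a0 !subr0.
have p_gt0 a w : 0 < a -> 0 < w -> 0 < p a w.
  by move=> a0 w0; have := ppos 0 0 a w a0 w0; rewrite /trans_dens a0 !subr0.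
have td_ge0 a x b y : 0 <= trans_dens p a x b y.
  have [ba|ab] := leP b a; first by rewrite p0//; left.
  have [yx|xy] := leP y x; first by rewrite p0//; right.
  exact/ltW/ppos.
(* The pair x = 0, y = 1 contributes a nonnegative element, so the supremum is not -oo and, with
   [Coo], is a real number. *)
have C0 : (0 <= C)%E.
  apply: le_trans (ereal_sup_ubound (_ : V _)); last first.
    by exists 0, 1; split; [exact: ltr01|reflexivity].
  apply: integral_ge0 => u _; apply: integral_ge0 => z _.
  by rewrite mule_ge0// lee_fin mulr_ge0 ?mulr_ge0 ?invr_ge0.
have CE : C = (fine C)%:E by rewrite fineK// ge0_fin_numE.
have ts0 : 0 < t - s by rewrite subr_gt0.
have [mp pE] := Xp _ ts0.
have mg := measurable_subdens XS.
apply: le_lt_trans (ltry (2 * fine C / (t - s) + 1)).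
(* The kernel is the jointly measurable [subdens], while [r] remains the given density p_{t-s}, the
   denominator in the assumption. *)
apply: (@ess_sup_le_bridge_bound R (subdens P X) (p (t - s)) q s t (fine C)) => //.
- exact: subdens_ge0.
- exact: subdens_eq0.
- by move=> h; exact: p_gt0.
- move=> e; rewrite -pE//; apply: le_lt_trans (ltry 1).
  apply: probability_le1; have [[mX _ _ _ _] _] := XS.
  by rewrite -[X in measurable X]setTI; exact: (mX (t - s) measurableT).
- exact: fine_ge0.
- move=> u e /andP[su ut]; rewrite (chapman_kolmogorov XS Xp p_eq0 p_gt0) ?subr_gt0//.
  by rewrite addrC addrA subrK.
move=> x h h0.
have ph0 := p_gt0 _ _ ts0 h0.
(* Dividing by p_{t-s}(h) gives the element of [V] for the pair x, x + h. *)
rewrite -CE muleC -lee_pdivrMl// -ge0_integralZl//; last 3 first.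
- apply: measurable_funTS; apply: measurable_bridge_integral => //.
  exact: subdens_ge0.
- move=> u _; apply: integral_ge0 => w _.
  by rewrite mule_ge0// lee_fin mulr_ge0// subdens_ge0.
- by rewrite lee_fin invr_ge0 ltW.
apply: ereal_sup_ubound; exists x, (x + h); split; first by rewrite ltrDl.
apply: eq_integral => u; rewrite inE/= in_itv/= => sut.
by rewrite (integral_bridgeE XS Xp p_eq0 p_gt0).
Qed.
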